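(* Let $f_1,\dots,f_m:\mathbb{R}^n\to\mathbb{R}$ be convex and continuously differentiable, each $\nabla f_i$ being $L_i$-Lipschitz continuous for a given $L_i\ge 0$. Let $g:\mathbb{R}^m\to\mathbb{R}\cup\{+\infty\}$ be convex, proper, lower semicontinuous, $L_g$-Lipschitz continuous on its domain (i.e. $|g(u)-g(v)|\le L_g\|u-v\|$ for all $u,v\in\mathrm{dom}\,g$), and nondecreasing in its $i$-th argument for every $i$ with $L_i>0$. Put $F=(f_1,\dots,f_m)$, $\bm{L}=(L_1,\dots,L_m)^T$ and $H(x,y)=F(x)+\nabla F(x)(y-x)+\frac{\bm{L}}{2}\|y-x\|^2$. Assume that $g\circ F$ is proper and has a minimizer, that for every $x\in F^{-1}(\mathrm{dom}\,g)$ the function $y\mapsto g(H(x,y))$ has a minimizer, and that $F^{-1}(\mathrm{int}\,\mathrm{dom}\,g)\ne\emptyset$. Let $S=\mathrm{argmin}\, g\circ F$. Let $(x_k)_{k\in\mathbb{N}}$ be a sequence generated by the multiproximal method: $x_0\in F^{-1}(\mathrm{dom}\,g)$ and, for every $k\in\mathbb{N}$, $x_{k+1}\in p(x_k)$, with $x_{k+1}=x_k$ whenever $x_k\in p(x_k)$. Then: (i) for every $x_*\in S$, setting $B_{x_0,x_*}=B(x_*,\|x_0-x_*\|)$, one has for all $k\ge 1$ $$g(F(x_k))-g(F(x_* ))\le \frac{\mathscr{C}_{g(F(x_0))}(B_{x_0,x_*})}{2k}\,\|x_0-x_*\|^2;$$ (ii) the sequence $(x_k)_{k\in\mathbb{N}}$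 converges to a point of $S$.
   Context: $\|\cdot\|$ is the Euclidean norm; $B(x,r)$ is the closed Euclidean ball of center $x$ and radius $r$; $\mathrm{dom}\,g=\{z: g(z)<+\infty\}$; $\partial g$ is the convex subdifferential (empty outside $\mathrm{dom}\,g$); $\nabla F(x)$ is the $m\times n$ Jacobian of $F$ at $x$. For $x\in F^{-1}(\mathrm{dom}\,g)$, $p(x)=\mathrm{argmin}_{y\in\mathbb{R}^n}\, g(H(x,y))$. For $y\in p(x)$, the set of multipliers is $$\mathcal{V}(x,y)=\{\nu\in\partial g(H(x,y)):\ \nabla_yH(x,y)^T\nu=0\},$$ where $\nabla_yH(x,y)=\nabla F(x)+\bm{L}(y-x)^T$ is the Jacobian of $H(x,\cdot)$ at $y$. For a compact set $K\subset\mathbb{R}^n$ and $\gamma\ge\min g\circ F$, $$\mathscr{C}_\gamma(K)=\sup\big\{\inf\{\bm{L}^T\nu:\nu\in\mathcal{V}(x,y)\}:\ x\in K\cap F^{-1}(\mathrm{dom}\,g),\ g(F(x))\le\gamma,\ y\in p(x)\big\}.$$ *)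

(* Defs.v *)
From HB Require Import structures.
From mathcomp Require Export all_boot all_order all_algebra.
From mathcomp Require Export all_classical all_reals all_analysis.

Set Implicit Arguments.
Unset Strict Implicit.
Unset Printing Implicit Defensive.

Import Order.TTheory GRing.Theory Num.Theory.
Import numFieldNormedType.Exports.

Local Open Scope classical_set_scope.
Local Open Scope ring_scope.

(* Points of R^n are row vectors, as in the library's Jacobian: 'J f x is the
   n x m matrix with 'd f x h = h *m 'J f x, i.e. the transpose of the usual
   m x n Jacobian matrix. *)

Section Euclidean.
Variables (R : realType) (n : nat).
Implicit Types (u v x y : 'rV[R]_n) (h : 'rV[R]_n -> R).

Definition dotv u v : R := \sum_(i < n) u 0 i * v 0 i.

(* The library norm `|u| on 'rV[R]_n is the sup norm. *)
Definition enorm u : R := Num.sqrt (dotv u u).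

Definition eball x (r : R) : set 'rV[R]_n := [set y | enorm (y - x) <= r].

Definition gradient h x : 'rV[R]_n := \row_j 'D_(delta_mx 0 j) h x.

Definition C1_function h : Prop :=
  (forall x, differentiable h x) /\ continuous (gradient h).

Definition lipschitz_gradient (l : R) h : Prop :=
  forall x y, enorm (gradient h x - gradient h y) <= l * enorm (x - y).

End Euclidean.

Section ExtendedValued.
Variables (R : realType) (n : nat).
Implicit Types (h : 'rV[R]_n -> \bar R) (u v z : 'rV[R]_n).

Definition edom h : set 'rV[R]_n := [set z | (h z < +oo)%E].

Definition proper_function h : Prop :=
  (forall z, (-oo < h z)%E) /\ edom h !=set0.

(* Only meaningful for functions that never take the value -oo. *)
Definition convex_efunction h : Prop :=
  forall u v (t : R), 0 < t -> t < 1 ->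
    (h (t *: u + (1 - t) *: v)%R <= t%:E * h u + (1 - t)%:E * h v)%E.

Definition lipschitz_on_edom (l : R) h : Prop :=
  forall u v, edom h u -> edom h v ->
    (`|h u - h v| <= (l * enorm (u - v))%:E)%E.

Definition nondecreasing_in (i : 'I_n) h : Prop :=
  forall u v, (forall j, j != i -> u 0 j = v 0 j) -> u 0 i <= v 0 i ->
    (h u <= h v)%E.

Definition argmin h : set 'rV[R]_n := [set z | forall w, (h z <= h w)%E].

Definition subdifferential h z : set 'rV[R]_n :=
  [set nu | edom h z /\ forall w, (h z + (dotv nu (w - z))%:E <= h w)%E].

End ExtendedValued.

Section Multiprox.
Variables (R : realType) (n m : nat).
Variables (f : 'I_m -> 'rV[R]_n -> R) (L : 'rV[R]_m) (g : 'rV[R]_m -> \bar R).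
Implicit Types (x y : 'rV[R]_n).

Definition Fmap x : 'rV[R]_m := \row_i f i x.

Definition Hmap x y : 'rV[R]_m :=
  Fmap x + (y - x) *m 'J Fmap x + (enorm (y - x) ^+ 2 / 2) *: L.

Definition prox x : set 'rV[R]_n := argmin (fun y => g (Hmap x y)).

Definition multipliers x y : set 'rV[R]_m :=
  [set nu | subdifferential g (Hmap x y) nu /\ nu *m ('J (Hmap x) y)^T = 0].

(* Supremum and infimum are taken in \bar R, so the infimum over an empty set
   of multipliers is +oo. *)
Definition complexity (gamma : \bar R) (K : set 'rV[R]_n) : \bar R :=
  ereal_sup [set c | exists x y,
    [/\ K x, edom g (Fmap x), (g (Fmap x) <= gamma)%E, prox x y &
        c = ereal_inf [set (dotv L nu)%:E | nu in multipliers x y]]].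

Definition multiprox_sequence (x_ : nat -> 'rV[R]_n) : Prop :=
  edom g (Fmap (x_ 0%N)) /\
  forall k, prox (x_ k) (x_ k.+1) /\ (prox (x_ k) (x_ k) -> x_ k.+1 = x_ k).

End Multiprox.

(* Main.v *)
(* For y in prox x and any z, convexity of F and the descent lemma give, in the
   order that is coordinatewise comparison where L_i > 0 and equality where
   L_i = 0 (there f_i is affine), that H(x, t z + (1 - t) y) is below
   t (F z + e L) + (1 - t) H(x, y) as soon as
   |z - x|^2 - (1 - t) |z - y|^2 <= 2 e.  Since g is monotone for this order and
   y minimizes g (H(x, .)), this yields g (F y) <= g (F z + e L) whenever
   |z - x|^2 - |z - y|^2 < 2 e.  With e = 0 this is Fejer monotonicity with
   respect to S as long as the iterates are not optimal.  With z on a segment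
   from a minimizer to a Slater point and e > 0 small, it shows without any
   multiplier that g (F x_k) tends to the minimum, as |z - x_k|^2 cannot drop by
   2 e forever.  Cluster points are then optimal, and Fejer monotonicity gives
   convergence.
   For the rate, a multiplier nu at (x, y) makes <nu, H(x, .)> a quadratic of
   curvature <L, nu> critical at y, so that g (F y) - g (F z) is at most
   <L, nu> / 2 (|z - x|^2 - |z - y|^2); these bounds telescope. *)

Require Import Defs.
From mathcomp Require Import ring lra.
Set Implicit Arguments.
Unset Strict Implicit.
Unset Printing Implicit Defensive.
Import Order.TTheory GRing.Theory Num.Theory.
Import numFieldNormedType.Exports.
Local Open Scope classical_set_scope.
Local Open Scope ring_scope.

(** * Euclidean inner product and norm *)

Section DotProduct.
Variables (R : realType) (n : nat).
Implicit Types u v w : 'rV[R]_n.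

Lemma dotvC u v : dotv u v = dotv v u.
Proof. by apply: eq_bigr => i _; rewrite mulrC. Qed.

Lemma dotvDl u v w : dotv (u + v) w = dotv u w + dotv v w.
Proof.
by rewrite /dotv -big_split; apply: eq_bigr => i _; rewrite !mxE mulrDl.
Qed.

Lemma dotvZl (a : R) u v : dotv (a *: u) v = a * dotv u v.
Proof. by rewrite /dotv mulr_sumr; apply: eq_bigr => i _; rewrite !mxE mulrA. Qed.

Lemma dotvDr u v w : dotv u (v + w) = dotv u v + dotv u w.
Proof. by rewrite dotvC dotvDl !(dotvC u). Qed.

Lemma dotvZr (a : R) u v : dotv u (a *: v) = a * dotv u v.
Proof. by rewrite dotvC dotvZl dotvC. Qed.

Lemma dotvNl u v : dotv (- u) v = - dotv u v.
Proof. by rewrite -scaleN1r dotvZl mulN1r. Qed.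

Lemma dotvNr u v : dotv u (- v) = - dotv u v.
Proof. by rewrite dotvC dotvNl dotvC. Qed.

Definition dotvE := (dotvDl, dotvDr, dotvNl, dotvNr, dotvZl, dotvZr).

Lemma dotvv_ge0 u : 0 <= dotv u u.
Proof. by apply: sumr_ge0 => i _; rewrite -expr2 sqr_ge0. Qed.

Lemma enorm_ge0 u : 0 <= enorm u.
Proof. exact: sqrtr_ge0. Qed.

Lemma sqr_enorm u : enorm u ^+ 2 = dotv u u.
Proof. by rewrite sqr_sqrtr ?dotvv_ge0. Qed.

Lemma enorm0 : enorm (0 : 'rV[R]_n) = 0.
Proof. by rewrite /enorm -(scale0r 0) dotvZl mul0r sqrtr0. Qed.

Lemma enormZ (a : R) u : enorm (a *: u) = `|a| * enorm u.
Proof.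
by rewrite /enorm dotvZl dotvZr mulrA -expr2 sqrtrM ?sqr_ge0// sqrtr_sqr.
Qed.

Lemma norm_coord_le_enorm u i : `|u 0 i| <= enorm u.
Proof.
rewrite -sqrtr_sqr /enorm ler_wsqrtr// /dotv (bigD1 i)//= -expr2.
by rewrite lerDl sumr_ge0// => k _; rewrite -expr2 sqr_ge0.
Qed.

Lemma mx_norm_le_enorm u : `|u| <= enorm u.
Proof.
rewrite [leLHS]/Num.norm/= mx_normrE; apply/bigmax_leP; split=> [|[i j] _/=].
  exact: enorm_ge0.
by rewrite ord1 norm_coord_le_enorm.
Qed.

Lemma ler_enorm u v : (enorm u <= enorm v) = (dotv u u <= dotv v v).
Proof. by rewrite /enorm ler_sqrt ?dotvv_ge0. Qed.

Lemma enorm_eq0 u : enorm u = 0 -> u = 0.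
Proof.
by move=> u0; apply/eqP; rewrite -normr_le0 -u0 mx_norm_le_enorm.
Qed.

Lemma dotv_le_enorm u v : dotv u v <= enorm u * enorm v.
Proof.
have [/enorm_eq0 -> | u0] := eqVneq (enorm u) 0.
  by rewrite enorm0 mul0r -(scale0r 0) dotvZl mul0r.
have [/enorm_eq0 -> | v0] := eqVneq (enorm v) 0.
  by rewrite enorm0 mulr0 -(scale0r 0) dotvZr mul0r.
have uv0 : 0 < enorm u * enorm v by rewrite mulr_gt0// lt_neqAle eq_sym ?u0 ?v0 enorm_ge0.
(* Expanded, this square is [2 |u| |v| (|u| |v| - <u, v>)], which is Cauchy-Schwarz after cancelling
   the positive factor. *)
have := dotvv_ge0 (enorm v *: u - enorm u *: v).
rewrite !dotvE (dotvC v u) -!sqr_enorm => H.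
rewrite -(ler_pM2l uv0); nra.
Qed.

Lemma differentiable_dotv_sqr (a y : 'rV[R]_n) :
  differentiable (fun z => dotv (z - a) (z - a)) y.
Proof.
have -> : (fun z => dotv (z - a) (z - a)) =
    \sum_(i < n) (fun z : 'rV[R]_n => (z 0 i - a 0 i) * (z 0 i - a 0 i)).
  by rewrite fct_sumE; apply/funext => z; apply: eq_bigr => i _; rewrite !mxE.
apply: differentiable_sum => i.
have dF : differentiable (fun z : 'rV[R]_n => z 0 i - a 0 i) y.
  by apply: differentiableB => //; exact: differentiable_coord.
exact: (differentiableM dF dF).
Qed.

End DotProduct.

(** * Descent lemma and tangent inequality along a line *)

Section LipschitzGradient.
Variables (R : realType) (n : nat).
Implicit Types (h : 'rV[R]_n -> R) (x y : 'rV[R]_n).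

Lemma derive_gradient h x v : differentiable h x -> 'D_v h x = dotv v (gradient h x).
Proof.
move=> dh; rewrite deriveE// {1}(row_sum_delta v) linear_sum /dotv.
by apply: eq_bigr => i _; rewrite linearZ/= !mxE -deriveE.
Qed.

Lemma is_derive_line h x v (t : R) : differentiable h (x + t *: v) ->
  is_derive t 1 (fun s => h (x + s *: v)) (dotv v (gradient h (x + t *: v))).
Proof.
move=> dh; have := diff_derivable (v := v) dh; rewrite -(derive_gradient v dh).
rewrite /derive /derivable.
set F := (X in cvg (X @ _)); set G := (X in lim (X @ _)).
move=> cF.
have E : F = (fun s => s^-1 *: ((fun s => h (x + s *: v)) (s *: 1 + t) - h (x + t *: v))).
  apply/funext => s; rewrite /F/=; congr (_ *: (h _ - _)).
  by rewrite [s%:A]mulr1 scalerDl addrCA.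
by split; rewrite /derivable /derive/= -?E.
Qed.

Lemma le_taylor1 (phi d : R -> R) (l : R) :
  (forall t : R, is_derive t (1 : R) phi (d t)) ->
  (forall t, 0 <= t -> d t - d 0 <= l * t) ->
  phi 1 - phi 0 - d 0 <= l / 2.
Proof.
move=> dphi dl.
(* The derivative of [psi] is nonpositive on nonnegative reals, so the mean value theorem gives
   [psi 1 <= psi 0]. *)
pose psi : R -> R := phi - (d 0 \*: id + (l / 2) \*: (id ^+ 2)).
have psiE t : psi t = phi t - (d 0 * t + l / 2 * t ^+ 2) by [].
have dpsi (t : R) : is_derive t (1 : R) psi (d t - (d 0 + l * t)).
  by apply: is_derive_eq; rewrite /GRing.scale/= !mulr1 expr1; lra.
have [|c] := @MVT R psi (fun t => d t - (d 0 + l * t)) 0 1 ltr01 (fun t _ => dpsi t).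
  by apply: derivable_within_continuous => t _; case: (dpsi t).
rewrite in_itv/= => /andP[c0 _]; rewrite !psiE.
by have := dl c (ltW c0); lra.
Qed.

Lemma gradient_descent_bounds h (l : R) x y : (forall z, differentiable h z) ->
  0 <= l -> lipschitz_gradient l h ->
  `|h y - h x - dotv (y - x) (gradient h x)| <= l / 2 * dotv (y - x) (y - x).
Proof.
move=> dh l0 hl; set v := y - x; rewrite mulrAC.
pose d t := dotv v (gradient h (x + t *: v)).
have dline (t : R) : is_derive t (1 : R) (fun s => h (x + s *: v)) (d t).
  exact: is_derive_line.
have d0E : d 0 = dotv v (gradient h x) by rewrite /d scale0r addr0.
(* Stated for any [w] as long as [v], so that [w = v] gives the upper bound and [w = - v] the lower
   one. *)
have inc t w : 0 <= t -> enorm w = enorm v ->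
    dotv w (gradient h (x + t *: v) - gradient h x) <= l * dotv v v * t.
  move=> t0 wv; apply: (le_trans (dotv_le_enorm _ _)); rewrite wv -sqr_enorm.
  have := hl (x + t *: v) x; rewrite [in X in _ <= X]addrC addKr enormZ ger0_norm// => H.
  have := enorm_ge0 v; nra.
have v1 : h y = h (x + 1 *: v) by rewrite scale1r /v addrC subrK.
have v0 : h x = h (x + 0 *: v) by rewrite scale0r addr0.
rewrite ler_norml lerNl; apply/andP; split; last first.
  rewrite v1 {1}v0 -d0E.
  apply: (@le_taylor1 (fun s => h (x + s *: v))) => // t t0.
  by rewrite d0E /d -dotvNr -dotvDr inc.
have -> : - (h y - h x - dotv v (gradient h x)) = - h y - - h x - - d 0.
  by rewrite d0E; ring.
rewrite v1 {1}v0.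
apply: (@le_taylor1 (fun s => - h (x + s *: v)) (fun t => - d t)) => t t0.
rewrite d0E /d.
have <- : dotv (- v) (gradient h (x + t *: v) - gradient h x) =
    - dotv v (gradient h (x + t *: v)) - - dotv v (gradient h x).
  by rewrite !dotvE; ring.
by rewrite inc// /enorm dotvNl dotvNr opprK.
Qed.

Lemma convex_function_le h : convex_function [set: 'rV[R]_n] h ->
  forall x y (t : R), 0 <= t -> t <= 1 ->
  h (t *: x + (1 - t) *: y) <= t * h x + (1 - t) * h y.
Proof.
move=> hc x y t t0 t1.
have tP : Itv.spec (@Itv.num_sem _) (Itv.Real `[0%Z, 1%Z]) t.
  by rewrite /= /Itv.num_sem num_real/= in_itv/= t0 t1.
have := hc (Itv.mk tP) x y; rewrite !in_setT => /(_ isT isT).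
by [].
Qed.

(** Convexity on the segment is compared with the lower descent bound at [x + t v]; the quadratic
    error, divided by [t], vanishes as [t] tends to 0. *)
Lemma convex_ge_tangent h (l : R) x y : (forall z, differentiable h z) ->
  0 <= l -> lipschitz_gradient l h -> convex_function [set: 'rV[R]_n] h ->
  dotv (y - x) (gradient h x) <= h y - h x.
Proof.
move=> dh l0 hl /convex_function_le hc; set v := y - x.
have B (t : R) : 0 < t -> t <= 1 ->
    dotv v (gradient h x) <= h y - h x + t * (l / 2 * dotv v v).
  move=> t0 t1.
  have := gradient_descent_bounds x (x + t *: v) dh l0 hl.
  rewrite [x + _]addrC addrK ler_norml => /andP[+ _].
  have := hc y x t (ltW t0) t1.
  have -> : t *: y + (1 - t) *: x = t *: v + x.
    by rewrite scalerBl scale1r scalerBr addrAC addrA.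
  rewrite !dotvE => h1 h2.
  rewrite -(ler_pM2l t0); nra.
apply/ler_addgt0Pr => e e0.
have c0 : 0 <= l / 2 * dotv v v by rewrite mulr_ge0 ?divr_ge0 ?dotvv_ge0.
set c := l / 2 * dotv v v in B c0.
(* Makes [t * c <= e]; the [+ 1] covers [c = 0]. *)
pose t := Num.min 1 (e / (c + 1)).
have t0 : 0 < t by rewrite lt_min ltr01/= divr_gt0// ltr_wpDl.
apply: (le_trans (B t t0 _)); first by rewrite ge_min lexx.
rewrite lerD2l; apply: (@le_trans _ _ (e / (c + 1) * c)).
  by rewrite ler_wpM2r// ge_min lexx orbT.
rewrite mulrAC ler_pdivrMr ?ltr_wpDl//.
nra.
Qed.

End LipschitzGradient.

(** * Jacobians computed coordinate by coordinate *)

Section Jacobian.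
Variables (R : realType) (n m : nat).
Implicit Types (M : 'rV[R]_n -> 'rV[R]_m) (x y v : 'rV[R]_n).

Lemma differentiable_row M x :
  (forall i, differentiable (fun y => M y 0 i) x) -> differentiable M x.
Proof.
move=> dM.
have -> : M = \sum_(i < m) (fun y => M y 0 i *: delta_mx 0 i).
  by rewrite fct_sumE; apply/funext => y; rewrite -row_sum_delta.
by apply: differentiable_sum => i; exact: differentiableZl.
Qed.

Lemma mul_jacobianE M x v i : (forall j, differentiable (fun y => M y 0 j) x) ->
  (v *m 'J M x) 0 i = 'D_v (fun y => M y 0 i) x.
Proof.
move=> dM; have dMx := differentiable_row dM.
rewrite -deriveEjacobian// derive_mx ?mxE//.
exact: diff_derivable.
Qed.

(** Reduces the Jacobian of [H x] to reading off the linear coefficient in [s]. *)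
Lemma derive_quadratic (h : 'rV[R]_n -> R) y v (a b c : R) :
  differentiable h y -> (forall s : R, h (y + s *: v) = a + s * b + s ^+ 2 * c) ->
  'D_v h y = b.
Proof.
move=> dh hE.
have := @is_derive_line _ _ h y v 0; rewrite scale0r addr0 -derive_gradient// => /(_ dh).
have -> : (fun s => h (y + s *: v)) = cst a + (b \*: id + c \*: (id ^+ 2)).
  by apply/funext => s; rewrite hE/= -addrA; congr (_ + (_ + _)); exact: mulrC.
move=> [_ <-].
have did := is_derive_id (0 : R) (1 : R).
have dlin := @is_deriveZ _ _ _ _ b _ _ _ did.
have dsqr := @is_deriveZ _ _ _ _ c _ _ _ (@is_deriveX _ _ _ 2 _ _ _ did).
have [_ ->] := @is_deriveD _ _ _ _ _ _ _ _ _ (is_derive_cst (a : R) (0 : R) (1 : R))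
  (@is_deriveD _ _ _ _ _ _ _ _ _ dlin dsqr).
by rewrite expr1 mulr0 scale0r scaler0 addr0 add0r [LHS]mulr1.
Qed.

Lemma differentiable_dotvl (a w y : 'rV[R]_n) :
  differentiable (fun z => dotv (z - a) w) y.
Proof.
have -> : (fun z => dotv (z - a) w) =
    \sum_(i < n) (fun z : 'rV[R]_n => (z 0 i - a 0 i) *: w 0 i).
  by rewrite fct_sumE; apply/funext => z; apply: eq_bigr => i _; rewrite !mxE.
apply: differentiable_sum => i; apply: differentiableZl.
by apply: differentiableB => //; exact: differentiable_coord.
Qed.

End Jacobian.

Local Notation sqdist x y := (dotv (x - y) (x - y)).

Lemma lt_ereal_between (R : realType) (a : R) (b : \bar R) : (a%:E < b)%E ->
  exists2 c : R, (a%:E < c%:E)%E & (c%:E < b)%E.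
Proof.
case: b => [b| |//]; last by exists (a + 1); rewrite ?ltry// lte_fin ltrDl.
by rewrite lte_fin => /midf_lt[ac cb]; exists ((a + b) / 2); rewrite lte_fin.
Qed.

(** * The order for which [g] is monotone, and the quadratic model [H] *)

Section Model.
Variables (R : realType) (n m : nat).
Variables (f : 'I_m -> 'rV[R]_n -> R) (L : 'rV[R]_m) (g : 'rV[R]_m -> \bar R).
Hypothesis L_ge0 : forall i, 0 <= L 0 i.
Hypothesis f_convex : forall i, convex_function [set: 'rV[R]_n] (f i).
Hypothesis f_C1 : forall i, C1_function (f i).
Hypothesis f_lip : forall i, lipschitz_gradient (L 0 i) (f i).
Hypothesis g_convex : convex_efunction g.
Hypothesis g_gtNy : forall u, (-oo < g u)%E.
Hypothesis g_mono : forall i, 0 < L 0 i -> nondecreasing_in i g.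
Implicit Types (x y z : 'rV[R]_n) (u v : 'rV[R]_m).

Local Notation F := (Fmap f).
Local Notation H := (Hmap f L).

Lemma sqdistC x y : sqdist x y = sqdist y x.
Proof. by rewrite -opprB dotvNl dotvNr opprK. Qed.

Let f_diff i x : differentiable (f i) x.
Proof. by have [] := f_C1 i. Qed.

Let L_eq0_or_gt0 i : L 0 i = 0 \/ 0 < L 0 i.
Proof. by have := L_ge0 i; rewrite le_eqVlt => /predU1P[<-|]; [left|right]. Qed.

Lemma differentiable_Fmap x i : differentiable (fun y => F y 0 i) x.
Proof. by under eq_fun do rewrite mxE; exact: f_diff. Qed.

Lemma HmapE x y i : H x y 0 i =
  f i x + dotv (y - x) (gradient (f i) x) + sqdist y x / 2 * L 0 i.
Proof.
rewrite !mxE sqr_enorm; congr (_ + _ + _).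
have := mul_jacobianE (y - x) i (differentiable_Fmap x); rewrite mxE => ->.
rewrite -derive_gradient//; congr ('D_ _ _ _).
by apply/funext => z; rewrite mxE.
Qed.

(* [g] is monotone along this preorder, although no monotonicity is assumed in
   the coordinates where [f i] is affine. *)
Definition coord_le u v :=
  forall i, (u 0 i <= v 0 i) /\ (L 0 i = 0 -> u 0 i = v 0 i).

Lemma g_coord_le u v : coord_le u v -> (g u <= g v)%E.
Proof.
move=> uv.
(* Passes from [u] to [v] one coordinate at a time; each step either changes nothing or raises a
   coordinate in which [g] is nondecreasing. *)
pose w k : 'rV[R]_m := \row_i if (i < k)%N then v 0 i else u 0 i.
have guw k : (g u <= g (w k))%E.
  elim: k => [|k IH].
    by suff -> : w 0%N = u by []; apply/rowP => i; rewrite mxE.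
  apply: (le_trans IH).
  have [km|mk] := ltnP k m; last first.
    suff -> : w k.+1 = w k by [].
    by apply/rowP => i; rewrite !mxE !(leq_trans (ltn_ord i)) ?leqW.
  pose i := Ordinal km.
  have wj j : j != i -> w k 0 j = w k.+1 0 j.
    rewrite -val_eqE/= => ji; rewrite !mxE ltnS.
    by rewrite [in RHS]leq_eqVlt (negbTE ji).
  have wi : w k 0 i = u 0 i by rewrite mxE ltnn.
  have wSi : w k.+1 0 i = v 0 i by rewrite mxE ltnSn.
  have [Li|Li] := L_eq0_or_gt0 i.
    suff -> : w k = w k.+1 by [].
    apply/rowP => j; have [->|/wj//] := eqVneq j i.
    by rewrite wi wSi; apply: (uv i).2.
  by apply: (g_mono Li) => //; rewrite wi wSi; exact: (uv i).1.
suff -> : v = w m by [].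
by apply/rowP => i; rewrite mxE ltn_ord.
Qed.

(** With Lipschitz constant 0 the two-sided descent bound collapses to an equality. *)
Let fi_affine i x y : L 0 i = 0 -> f i y = f i x + dotv (y - x) (gradient (f i) x).
Proof.
move=> Li.
have := gradient_descent_bounds x y (f_diff i) (L_ge0 i) (f_lip i).
by rewrite Li mul0r mul0r normr_le0 => /eqP; lra.
Qed.

(** Upper half of the descent bound. *)
Lemma Fmap_le_Hmap x y : coord_le (F y) (H x y).
Proof.
move=> i; rewrite HmapE [F y 0 i]mxE; split; last first.
  by move=> Li; rewrite Li mulr0 addr0; exact: fi_affine.
have := gradient_descent_bounds x y (f_diff i) (L_ge0 i) (f_lip i).
rewrite ler_norml => /andP[_]; lra.
Qed.

(** The linear part of [H x] lies below [F] by the tangent inequality; only the quadratic term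
    remains. *)
Lemma Hmap_le_Fmap x y : coord_le (H x y) (F y + (sqdist y x / 2) *: L).
Proof.
move=> i; rewrite HmapE !mxE; split; last first.
  by move=> Li; rewrite Li !mulr0 !addr0; exact/esym/fi_affine.
have := convex_ge_tangent x y (f_diff i) (L_ge0 i) (f_lip i) (f_convex i); lra.
Qed.

Lemma Fmap_convex x y (t : R) : 0 <= t -> t <= 1 ->
  coord_le (F (t *: x + (1 - t) *: y)) (t *: F x + (1 - t) *: F y).
Proof.
move=> t0 t1 i; rewrite !mxE; split; first exact: convex_function_le.
(* In an affine coordinate both values are expanded about [c], and the weighted displacements
   cancel. *)
move=> Li; set c := t *: x + _.
rewrite (fi_affine c x Li) (fi_affine c y Li).
have : dotv (t *: (x - c) + (1 - t) *: (y - c)) (gradient (f i) c) = 0.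
  suff -> : t *: (x - c) + (1 - t) *: (y - c) = 0 by rewrite -(scale0r 0) dotvZl mul0r.
  by apply/rowP => j; rewrite !mxE; ring.
rewrite (dotvDl (t *: (x - c))) (dotvZl t) (dotvZl (1 - t)); lra.
Qed.

Lemma Hmapxx x : H x x = F x.
Proof. by apply/rowP => i; rewrite HmapE subrr -(scale0r 0) !dotvZl !mul0r mxE !addr0. Qed.

Lemma Hmap_segment x y z (t e : R) : 0 <= t ->
  sqdist z x - (1 - t) * sqdist z y <= 2 * e ->
  coord_le (H x (t *: z + (1 - t) *: y)) (t *: (F z + e *: L) + (1 - t) *: H x y).
Proof.
move=> t0 te i; have [Hz Hz0] := Hmap_le_Fmap x z i.
(* Each coordinate of [H x] is a quadratic of curvature [L 0 i], so its convexity defect on the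
   segment is exact. *)
have HE : H x (t *: z + (1 - t) *: y) 0 i =
    t * H x z 0 i + (1 - t) * H x y 0 i - t * (1 - t) / 2 * sqdist z y * L 0 i.
  rewrite !HmapE.
  have -> : t *: z + (1 - t) *: y - x = t *: (z - x) + (1 - t) *: (y - x).
    by apply/rowP => j; rewrite !mxE; ring.
  have -> : z - y = (z - x) - (y - x) by rewrite opprB addrA subrK.
  move: (z - x) (y - x) => p q; rewrite !dotvE (dotvC q p); by field.
have -> : (t *: (F z + e *: L) + (1 - t) *: H x y) 0 i =
    t * (F z 0 i + e * L 0 i) + (1 - t) * H x y 0 i by rewrite !mxE.
have HzE : (F z + (sqdist z x / 2) *: L) 0 i = F z 0 i + sqdist z x / 2 * L 0 i.
  by rewrite !mxE.
rewrite HzE in Hz Hz0; rewrite HE; split; last first.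
  by move=> Li; rewrite (Hz0 Li) Li; ring.
have h1 : t * H x z 0 i <= t * (F z 0 i + sqdist z x / 2 * L 0 i) by rewrite ler_wpM2l.
have h2 : t * L 0 i * (sqdist z x - (1 - t) * sqdist z y) <= t * L 0 i * (2 * e).
  by rewrite ler_wpM2l// mulr_ge0.
lra.
Qed.

(** * A single proximal step from [x] to [y] *)

Section ProxStep.
Variables x y : 'rV[R]_n.
Hypothesis x_dom : edom g (F x).
Hypothesis xy : prox f L g x y.

Lemma g_Hmap_prox_le : (g (H x y) <= g (F x))%E.
Proof. by rewrite -(Hmapxx x); exact: xy. Qed.

Lemma g_Fmap_prox_le : (g (F y) <= g (H x y))%E.
Proof. exact/g_coord_le/Fmap_le_Hmap. Qed.

Lemma g_prox_fin : g (H x y) \is a fin_num.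
Proof.
by rewrite fin_numElt g_gtNy (le_lt_trans g_Hmap_prox_le).
Qed.

Lemma prox_le_shift z (e : R) : sqdist z x - sqdist z y < 2 * e ->
  (g (H x y) <= g (F z + e *: L))%E.
Proof.
move=> ze; have [gz|] := ltP (g (F z + e *: L)) +oo%E; last first.
  by rewrite leye_eq => /eqP ->; exact: leey.
(* The strict hypothesis leaves a slack [r > 0], and [t] is taken small enough that
   [t * sqdist z y <= r]. *)
have [t [t0 t1 te]] : exists t : R, [/\ 0 < t, t < 1 &
    sqdist z x - (1 - t) * sqdist z y <= 2 * e].
  set d := sqdist z y in ze *; set r := 2 * e - (sqdist z x - d).
  have r0 : 0 < r by rewrite subr_gt0.
  have d0 : 0 <= d by exact: dotvv_ge0.
  exists (r / (r + d + 1)).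
  have k0 : 0 < r + d + 1 by lra.
  split; first by rewrite divr_gt0.
    by rewrite ltr_pdivrMr// mul1r; lra.
  suff : r / (r + d + 1) * d <= r by rewrite /r; lra.
  by rewrite mulrAC ler_pdivrMr//; nra.
(* Minimality of [y], monotonicity and convexity give [g (H x y) <= t g (F z + e L) + (1 - t) g (H x
   y)]; finiteness of [g (H x y)] lets it be cancelled. *)
have := xy (t *: z + (1 - t) *: y).
move=> /le_trans /(_ (g_coord_le (Hmap_segment (ltW t0) te))).
move=> /le_trans /(_ (g_convex _ _ t0 t1)).
have gzf : g (F z + e *: L) \is a fin_num by rewrite fin_numElt g_gtNy gz.
rewrite -(fineK g_prox_fin) -(fineK gzf) -!EFinM -EFinD !lee_fin => h.
rewrite -(ler_pM2l t0); lra.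
Qed.

(** Contrapositive of [prox_le_shift] with [e = 0]. *)
Lemma prox_fejer z : (g (F z) < g (F y))%E -> sqdist z y <= sqdist z x.
Proof.
rewrite leNgt; apply: contraTN; rewrite -subr_lt0 -(mulr0 2) -leNgt => /prox_le_shift.
by rewrite scale0r addr0; apply: le_trans; exact: g_Fmap_prox_le.
Qed.

Lemma mul_jacobian_Hmap w i : (w *m 'J (H x) y) 0 i =
  dotv w (gradient (f i) x) + dotv w (y - x) * L 0 i.
Proof.
have E j : (fun y => H x y 0 j) = cst (f j x) +
    (fun y => dotv (y - x) (gradient (f j) x)) + (L 0 j / 2) \*: (fun y => sqdist y x).
  by apply/funext => z/=; rewrite HmapE mulrAC mulrC mulrA; congr (_ + _); rewrite mulrC mulrA.
have dH j : differentiable (fun y => H x y 0 j) y.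
  rewrite E; apply: differentiableD; last exact/differentiableZ/differentiable_dotv_sqr.
  by apply: differentiableD => //; exact: differentiable_dotvl.
rewrite mul_jacobianE//.
apply: (@derive_quadratic _ _ _ _ _ (H x y 0 i) _ (L 0 i / 2 * dotv w w)) => // s.
rewrite !HmapE addrAC !dotvE (dotvC w x) (dotvC w y) (dotvC y x).
by field.
Qed.

(** Lowering coordinate [i] by 1 does not increase [g], while the subgradient inequality bounds the
    change below by [- nu 0 i]. *)
Lemma multiplier_ge0 nu i : subdifferential g (H x y) nu ->
  0 < L 0 i -> 0 <= nu 0 i.
Proof.
move=> [_ nuP] Li; set u := H x y in nuP *.
have gu : (g (u - delta_mx 0 i)%R <= g u)%E.
  apply: (g_mono Li) => [j ji|]; rewrite !mxE eqxx/=.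
    by rewrite (negbTE ji) subr0.
  by rewrite eqxx/= lerBlDr lerDl.
have := le_trans (nuP (u - delta_mx 0 i)) gu.
rewrite [u - _ - u]addrC addKr dotvNr -(fineK g_prox_fin) -EFinD lee_fin gerDl oppr_le0.
rewrite /dotv (bigD1 i)//= big1 ?addr0 ?mxE ?eqxx ?mulr1// => j ji.
by rewrite mxE (negbTE ji) andbF mulr0.
Qed.

Lemma dotv_multiplier_ge0 nu : subdifferential g (H x y) nu -> 0 <= dotv L nu.
Proof.
move=> nuP; apply: sumr_ge0 => i _.
have [->|Li] := L_eq0_or_gt0 i; first by rewrite mul0r.
by rewrite mulr_ge0// (multiplier_ge0 nuP).
Qed.

(** The sign of [nu 0 i] is known only where [L 0 i > 0]; elsewhere the coordinates of [u] and [v]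
    agree. *)
Lemma dotv_coord_le nu u v : subdifferential g (H x y) nu -> coord_le u v ->
  dotv nu u <= dotv nu v.
Proof.
move=> nuP uv; apply: ler_sum => i _.
have [/(uv i).2 ->//|Li] := L_eq0_or_gt0 i.
by rewrite ler_wpM2l// ?(multiplier_ge0 nuP)// (uv i).1.
Qed.

(* [<nu, H x .>] is a quadratic polynomial of curvature [<L, nu>] with a
   critical point at [y]. *)
Lemma prox_multiplier_le z nu : multipliers f L g x y nu ->
  (g (H x y) <= g (F z) + (dotv L nu / 2 * (sqdist z x - sqdist z y))%:E)%E.
Proof.
move=> [nuP nu0].
have crit : dotv nu ((z - y) *m 'J (H x) y) = 0.
  have -> : dotv nu ((z - y) *m 'J (H x) y) = ((z - y) *m (nu *m ('J (H x) y)^T)^T) 0 0.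
    rewrite trmx_mul trmxK mulmxA [RHS]mxE.
    by apply: eq_bigr => i _; rewrite [nu^T _ _]mxE mulrC.
  by rewrite nu0 trmx0 mulmx0 mxE.
(* Exact second-order expansion at [y]; pairing with [nu] kills the linear term by [crit]. *)
have HE : H x z - H x y = (z - y) *m 'J (H x) y + (sqdist z y / 2) *: L.
  apply/rowP => i.
  have rowB (u v : 'rV[R]_m) : (u - v) 0 i = u 0 i - v 0 i by rewrite !mxE.
  rewrite rowB [RHS]mxE mul_jacobian_Hmap [(_ *: L) 0 i]mxE !HmapE.
  have -> : z - x = (z - y) + (y - x) by rewrite addrA subrK.
  move: (z - y) (y - x) => p q; rewrite !dotvE (dotvC q p); by field.
have := dotv_coord_le nuP (Hmap_le_Fmap x z).
have -> : H x z = H x y + ((z - y) *m 'J (H x) y + (sqdist z y / 2) *: L).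
  by rewrite -HE addrC subrK.
rewrite (dotvDr nu (H x y)) (dotvDr nu (_ *m _)) crit !(dotvZr _ nu) (dotvDr nu (F z)).
rewrite (dotvZr _ nu L) add0r => key.
have := nuP.2 (F z); rewrite (dotvDr nu (F z)) (dotvNr nu).
rewrite -(fineK g_prox_fin).
have [gz|] := ltP (g (F z)) +oo%E; last first.
  by rewrite leye_eq => /eqP -> _; rewrite addye// leey.
have gzf : g (F z) \is a fin_num by rewrite fin_numElt g_gtNy gz.
rewrite -(fineK gzf) -!EFinD !lee_fin (dotvC L nu); lra.
Qed.

End ProxStep.

(** * Descent, Fejer monotonicity and convergence of the iterates *)

Section Iterates.
Variables (x_ : nat -> 'rV[R]_n) (xs : 'rV[R]_n).
Hypothesis g_lsc : lower_semicontinuous g.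
Hypothesis interior_nonempty : Fmap f @^-1` (interior (edom g)) !=set0.
Hypothesis x_multiprox : multiprox_sequence f L g x_.
Hypothesis xs_min : argmin (g \o F) xs.

(** [H x] majorizes [F] and touches it at [x]. The stopping rule then freezes the sequence at its
    first optimal iterate. *)
Lemma argmin_prox x : argmin (g \o F) x -> prox f L g x x.
Proof.
move=> xmin y; rewrite Hmapxx; apply: (le_trans (xmin y)).
exact/g_coord_le/Fmap_le_Hmap.
Qed.

Lemma multiprox_dom k : edom g (F (x_ k)).
Proof.
elim: k => [|k IH]; first exact: x_multiprox.1.
have xk := (x_multiprox.2 k).1.
exact: le_lt_trans (g_Fmap_prox_le _ _) (le_lt_trans (g_Hmap_prox_le xk) IH).
Qed.

Lemma multiprox_step k : prox f L g (x_ k) (x_ k.+1).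
Proof. exact: (x_multiprox.2 k).1. Qed.

Lemma multiprox_descent j k : (j <= k)%N -> (g (F (x_ k)) <= g (F (x_ j)))%E.
Proof.
move=> /subnK <-; elim: (k - j)%N => // i IH; apply: le_trans IH.
by apply: (le_trans (g_Fmap_prox_le (x_ (i + j)) _)); exact/g_Hmap_prox_le/multiprox_step.
Qed.

Lemma multiprox_stationary j k : (j <= k)%N -> argmin (g \o F) (x_ j) -> x_ k = x_ j.
Proof.
move=> + xj; move=> /subnK <-; elim: (k - j)%N => // i IH.
by rewrite addSn (x_multiprox.2 _).2 IH//; exact: argmin_prox.
Qed.

Lemma lt_not_argmin x z : argmin (g \o F) z -> ~ argmin (g \o F) x ->
  (g (F z) < g (F x))%E.
Proof.
move=> zmin xmin; rewrite ltNge; apply/negP => xz; apply: xmin => w.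
exact: le_trans xz (zmin w).
Qed.

Lemma multiprox_fejer z j k : argmin (g \o F) z -> (j <= k)%N ->
  ~ argmin (g \o F) (x_ k) -> sqdist z (x_ k) <= sqdist z (x_ j).
Proof.
move=> zmin; elim: k => [|k IH]; first by rewrite leqn0 => /eqP ->.
rewrite leq_eqVlt => /predU1P[->//|jk] xk.
apply: (@le_trans _ _ (sqdist z (x_ k))).
  apply: prox_fejer; [exact: multiprox_dom|exact: multiprox_step|].
  exact: lt_not_argmin.
(* Non-optimality passes back to the previous iterate, since an optimal iterate would be
   repeated. *)
apply: IH => // /[dup] xk0 /(multiprox_stationary (leqnSn k)) xSk.
by apply: xk; rewrite xSk.
Qed.

Lemma min_fin : g (F xs) \is a fin_num.
Proof.
rewrite fin_numElt g_gtNy/=.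
exact: le_lt_trans (xs_min (x_ 0%N)) (multiprox_dom 0).
Qed.

Lemma slater_shift : exists xh, exists2 e : R, 0 < e & edom g (F xh + e *: L).
Proof.
have [xh xhP] := interior_nonempty; exists xh.
have [r r0 rP] := (nbhs_ballP _ _).1 xhP.
have L1 : 0 < `|L| + 1 by rewrite ltr_wpDl.
(* Keeps the norm of [e *: L] below [r], also when [L = 0]. *)
exists (r / 2 / (`|L| + 1)); first by rewrite !divr_gt0.
apply: rP; rewrite -ball_normE/= opprD addrA subrr sub0r normrN normrZ.
rewrite gtr0_norm ?divr_gt0// mulrAC ltr_pdivrMr//.
have := normr_ge0 L; have : 0 < r := r0; nra.
Qed.

(* Since [sqdist z (x_ k) >= 0] cannot drop by [2 s e] at every step, some step
   satisfies the hypothesis of [prox_le_shift] for the shift [s e] of a point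
   [z] on the segment from [xs] to a Slater point. *)
Lemma multiprox_value_cvg (eta : R) : (g (F xs) < eta%:E)%E ->
  exists k, (g (F (x_ k)) <= eta%:E)%E.
Proof.
move=> xs_eta; apply: contrapT => /forallNP no.
have {}no k : (eta%:E < g (F (x_ k)))%E by rewrite ltNge; apply/negP.
have [xh [e e0 xhe]] := slater_shift.
have Mfin : g (F xh + e *: L) \is a fin_num by rewrite fin_numElt g_gtNy.
set v := fine (g (F xs)); set M := fine (g (F xh + e *: L)).
have v_eta : v < eta by move: xs_eta; rewrite -(fineK min_fin) lte_fin.
(* [M] may be far above [eta], but a small weight on it suffices because [v < eta]. *)
have [s [s0 s1 sle]] : exists s : R, [/\ 0 < s, s < 1 & s * M + (1 - s) * v <= eta].
  have h0 : 0 < eta - v by rewrite subr_gt0.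
  have k0 : 0 < `|M - v| + (eta - v) + 1 by have := normr_ge0 (M - v); lra.
  exists ((eta - v) / (`|M - v| + (eta - v) + 1)); split.
  - by rewrite divr_gt0.
  - by rewrite ltr_pdivrMr// mul1r; have := normr_ge0 (M - v); lra.
  suff : (eta - v) / (`|M - v| + (eta - v) + 1) * (M - v) <= eta - v by lra.
  rewrite mulrAC ler_pdivrMr//.
  have := ler_norm (M - v); have := normr_ge0 (M - v); nra.
pose z := s *: xh + (1 - s) *: xs.
have gz : (g (F z + (s * e) *: L) <= eta%:E)%E.
  have zle : coord_le (F z + (s * e) *: L) (s *: (F xh + e *: L) + (1 - s) *: F xs).
    move=> i; have [h1 h2] := Fmap_convex xh xs (ltW s0) (ltW s1) i.
    have rE : (s *: (F xh + e *: L) + (1 - s) *: F xs) 0 i =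
      (s *: F xh + (1 - s) *: F xs) 0 i + s * e * L 0 i by rewrite !mxE; ring.
    have lE : (F z + (s * e) *: L) 0 i = F z 0 i + s * e * L 0 i.
      by rewrite [LHS]mxE [((s * e) *: L) 0 i]mxE.
    rewrite rE lE; split; first by rewrite lerD2r.
    by move=> /h2 ->.
  apply: (le_trans (g_coord_le zle)); apply: (le_trans (g_convex _ _ s0 s1)).
  by rewrite -(fineK Mfin) -(fineK min_fin) -!EFinM -EFinD lee_fin.
(* A smaller drop would bring the next value down to [eta] through [prox_le_shift] and [gz]. *)
have drop k : 2 * (s * e) <= sqdist z (x_ k) - sqdist z (x_ k.+1).
  rewrite leNgt; apply/negP => /(prox_le_shift (multiprox_dom k) (multiprox_step k)).
  move=> /(le_trans (g_Fmap_prox_le _ _)) /le_trans /(_ gz).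
  by rewrite leNgt no.
have dropn k : sqdist z (x_ k) <= sqdist z (x_ 0%N) - k%:R * (2 * (s * e)).
  elim: k => [|k IH]; first by rewrite mul0r subr0.
  by have := drop k; rewrite -natr1; lra.
have c0 : 0 < 2 * (s * e) by rewrite !mulr_gt0.
have := archi_boundP (divr_ge0 (dotvv_ge0 (z - x_ 0%N)) (ltW c0)).
set N := Num.bound _; rewrite ltr_pdivrMr// => NP.
have := dropn N; have := dotvv_ge0 (z - x_ N); lra.
Qed.

Lemma Fmap_continuous : continuous F.
Proof.
by move=> x; apply/differentiable_continuous/differentiable_row/differentiable_Fmap.
Qed.

Lemma multiprox_cluster_min xb :
  cluster (x_ @ \oo) xb -> argmin (g \o F) xb.
Proof.
move=> xbP; apply: contrapT => /(lt_not_argmin xs_min).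
rewrite -(fineK min_fin) => /lt_ereal_between[c]; rewrite (fineK min_fin).
move=> /multiprox_value_cvg[k kc] /g_lsc[V VF gV].
(* Lower semicontinuity keeps [g \o F] above [c] near [xb], yet some iterate past [k], of value at
   most [c], lies there. *)
have [_ [[j kj <-] /gV]] : (x_ @` [set j | (k <= j)%N]) `&` (F @^-1` V) !=set0.
  apply: xbP; last exact: Fmap_continuous.
  by exists k => // j /= kj; exists j.
by rewrite ltNge (le_trans (multiprox_descent kj)).
Qed.

Lemma multiprox_cvg : exists2 xb, argmin (g \o F) xb & x_ @ \oo --> xb.
Proof.
(* Either the sequence is eventually constant, or no iterate is optimal and the Fejer inequality
   holds at every index. *)
have [[k xk]|/forallNP no] := pselect (exists k, argmin (g \o F) (x_ k)).
  exists (x_ k) => //; apply: cvg_near_cst; exists k => // j /= kj.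
  exact: multiprox_stationary.
pose r := enorm (xs - x_ 0%N).
(* A compact box around the Euclidean ball that contains all iterates. *)
pose A := [set v : 'rV[R]_n | forall i, `[xs 0 i - r, xs 0 i + r]%classic (v 0 i)].
have cA : compact A.
  by apply: (@rV_compact _ _ (fun i => `[xs 0 i - r, xs 0 i + r]%classic)) => i;
    exact: segment_compact.
have [|xb [_ xbP]] := cA (x_ @ \oo) _.
  exists 0%N => // k _ i /=; rewrite in_itv/= -ler_distlC.
  have := norm_coord_le_enorm (xs - x_ k) i; rewrite !mxE => /le_trans; apply.
  by rewrite ler_enorm; apply: multiprox_fejer.
have xbmin := multiprox_cluster_min xbP; exists xb => //.
apply/cvgrPdist_lt => e e0.
(* One iterate close to [xb] is enough: [xb] is optimal, so Fejer monotonicity keeps all later ones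
   as close. *)
have [_ [[k _ <-] /= xke]] : range x_ `&` [set y | sqdist y xb < e ^+ 2] !=set0.
  apply: xbP; first by exists 0%N => // k _; exists k.
  have /differentiable_continuous/cvgr_lt := differentiable_dotv_sqr xb xb; apply.
  by rewrite subrr -(scale0r 0) dotvZl mul0r exprn_gt0.
exists k => // j /= kj; apply: (le_lt_trans (mx_norm_le_enorm _)).
rewrite -(ltr_pXn2r (n := 2)) ?nnegrE ?enorm_ge0 ?ltW// sqr_enorm.
by apply: le_lt_trans xke; rewrite sqdistC [leRHS]sqdistC sqdistC multiprox_fejer.
Qed.

(** * The complexity constant and the rate *)

Let r := enorm (x_ 0%N - xs).
Let C := complexity f L g (g (F (x_ 0%N))) (eball xs r).

Lemma inf_multipliers_le_complexity k : enorm (x_ k - xs) <= r ->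
  (ereal_inf [set (dotv L nu)%:E | nu in multipliers f L g (x_ k) (x_ k.+1)] <= C)%E.
Proof.
move=> kr; apply: ereal_sup_ubound; exists (x_ k), (x_ k.+1); split=> //.
- exact: multiprox_dom.
- exact: multiprox_descent.
- exact: multiprox_step.
Qed.

(** The first step already contributes a nonnegative infimum to the supremum; with no multiplier
    that infimum is [+oo]. *)
Lemma complexity_ge0 : (0 <= C)%E.
Proof.
apply: le_trans (@inf_multipliers_le_complexity 0 (lexx _)).
apply: le_ereal_inf_tmp => _ [nu [nuP _] <-]; rewrite lee_fin.
exact: (dotv_multiplier_ge0 (multiprox_dom 0) (multiprox_step 0)).
Qed.

Lemma multiprox_step_gap (c : R) k : (C <= c%:E)%E ->
  enorm (x_ k - xs) <= r -> sqdist xs (x_ k.+1) <= sqdist xs (x_ k) ->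
  (g (F (x_ k.+1)) <=
    g (F xs) + (c / 2 * (sqdist xs (x_ k) - sqdist xs (x_ k.+1)))%:E)%E.
Proof.
move=> Cc kr D0; set D := sqdist xs (x_ k) - _.
have {}D0 : 0 <= D by rewrite subr_ge0.
rewrite -(fineK min_fin) -EFinD; apply/lee_addgt0Pr => e e0.
have D1 : 0 < D + 1 by rewrite ltr_wpDl.
have e0' : 0 < 2 * e / (D + 1) by rewrite divr_gt0// mulr_gt0.
(* The infimum may not be attained, so a multiplier within [2 * e / (D + 1)] of the bound [c] is
   taken; the excess costs at most [e] once multiplied by [D / 2]. *)
have /ereal_inf_lt[_ [nu nuP <-]] :
    (ereal_inf [set (dotv L nu)%:E | nu in multipliers f L g (x_ k) (x_ k.+1)] <
     (c + 2 * e / (D + 1))%:E)%E.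
  apply: (le_lt_trans (inf_multipliers_le_complexity kr)).
  by apply: (le_lt_trans Cc); rewrite lte_fin ltrDl.
rewrite lte_fin => nuc.
apply: (le_trans (g_Fmap_prox_le _ _)).
apply: (le_trans (prox_multiplier_le (multiprox_dom k) (multiprox_step k) xs nuP)).
rewrite -(fineK min_fin) -!EFinD lee_fin -addrA lerD2l -/D.
have h1 : dotv L nu * D <= (c + 2 * e / (D + 1)) * D by rewrite ler_wpM2r// ltW.
have h2 : 2 * e / (D + 1) * D <= 2 * e.
  by rewrite mulrAC ler_pdivrMr//; nra.
lra.
Qed.

Lemma multiprox_rate k : (1 <= k)%N ->
  (g (F (x_ k)) - g (F xs) <= C * ((2 * k%:R)^-1)%:E * (r ^+ 2)%:E)%E.
Proof.
move=> k1.
have k0 : 0 < (k%:R : R) by rewrite ltr0n.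
(* At an optimal [x_ k] the gap is 0 and nonnegativity of [C] suffices; otherwise no earlier iterate
   is optimal, so Fejer monotonicity holds up to [k]. *)
have [xk|xk] := pselect (argmin (g \o F) (x_ k)).
  have -> : g (F (x_ k)) = g (F xs) by apply/le_anti; rewrite xk xs_min.
  rewrite subee; last exact: min_fin.
  apply: mule_ge0; last by rewrite lee_fin exprn_ge0// enorm_ge0.
  apply: mule_ge0; first exact: complexity_ge0.
  by rewrite lee_fin invr_ge0 mulr_ge0// ltW.
have xj j : (j <= k)%N -> ~ argmin (g \o F) (x_ j).
  by move=> jk /[dup] xj /(multiprox_stationary jk) xkj; apply: xk; rewrite xkj.
(* Excludes the product of [+oo] and 0, which is 0, when [C] is infinite. *)
have r0 : 0 < r.
  rewrite lt_neqAle eq_sym enorm_ge0 andbT; apply/eqP => /enorm_eq0/eqP.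
  rewrite subr_eq0 => /eqP x0; apply: (xj 0%N) => //; by rewrite x0.
have [[c Cc]|Coo|CNoo] : [\/ exists c : R, C = c%:E, C = +oo%E | C = -oo%E].
  by case: C => [c| |]; [constructor 1; exists c|constructor 2|constructor 3].
- have rad j : (j <= k)%N -> enorm (x_ j - xs) <= r.
    move=> jk; rewrite ler_enorm sqdistC [leRHS]sqdistC.
    by apply: multiprox_fejer => //; exact: xj.
  have fin j : g (F (x_ j)) \is a fin_num.
    by rewrite fin_numElt g_gtNy; exact: multiprox_dom.
  pose a := fine (g (F (x_ k))) - fine (g (F xs)).
  (* By descent each of the first [k] gaps is at least the last one, [a], so summing the one-step
     bounds yields [k * a]. *)
  have tele j : (j <= k)%N ->
      j%:R * a <= c / 2 * (sqdist xs (x_ 0%N) - sqdist xs (x_ j)).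
    elim: j => [|j IH] jk; first by rewrite mul0r subrr mulr0.
    have gap : a <= c / 2 * (sqdist xs (x_ j) - sqdist xs (x_ j.+1)).
      have Dj : sqdist xs (x_ j.+1) <= sqdist xs (x_ j).
        by apply: multiprox_fejer => //; exact: xj.
      have Cle : (C <= c%:E)%E by rewrite Cc.
      have := le_trans (multiprox_descent jk) (multiprox_step_gap Cle (rad j (ltnW jk)) Dj).
      rewrite -(fineK min_fin) -(fineK (fin k)) -EFinD lee_fin /a; lra.
    rewrite -natr1 mulrDl mul1r; apply: (le_trans (lerD (IH (ltnW jk)) gap)).
    by rewrite -mulrDr addrA subrK.
  have c0 : 0 <= c by rewrite -lee_fin -Cc complexity_ge0.
  rewrite Cc -(fineK min_fin) -(fineK (fin k)) -EFinB -!EFinM lee_fin -/a.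
  have -> : c * (2 * k%:R)^-1 * r ^+ 2 = (c / 2 * r ^+ 2) / k%:R.
    by rewrite invfM; ring.
  rewrite ler_pdivlMr// mulrC; apply: (le_trans (tele k (leqnn k))).
  rewrite ler_wpM2l ?divr_ge0// sqr_enorm sqdistC gerBl; exact: dotvv_ge0.
- rewrite Coo gt0_mulye ?lte_fin ?invr_gt0 ?mulr_gt0//.
  by rewrite gt0_mulye ?leey// lte_fin exprn_gt0.
- by have := complexity_ge0; rewrite CNoo.
Qed.

End Iterates.
End Model.

Theorem theorem1 (R : realType) (n m : nat)
    (f : 'I_m -> 'rV[R]_n -> R) (L : 'rV[R]_m)
    (g : 'rV[R]_m -> \bar R) (Lg : R)
    (L_ge0 : forall i, 0 <= L 0 i)
    (f_convex : forall i, convex_function [set: 'rV[R]_n] (f i))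
    (f_C1 : forall i, C1_function (f i))
    (f_lip : forall i, lipschitz_gradient (L 0 i) (f i))
    (g_convex : convex_efunction g)
    (g_proper : proper_function g)
    (g_lsc : lower_semicontinuous g)
    (g_lip : lipschitz_on_edom Lg g)
    (g_mono : forall i, 0 < L 0 i -> nondecreasing_in i g)
    (gF_proper : proper_function (g \o Fmap f))
    (gF_min : argmin (g \o Fmap f) !=set0)
    (prox_nonempty : forall x, edom g (Fmap f x) -> prox f L g x !=set0)
    (interior_nonempty : Fmap f @^-1` (interior (edom g)) !=set0)
    (x_ : nat -> 'rV[R]_n)
    (x_multiprox : multiprox_sequence f L g x_) :
  (forall xs, argmin (g \o Fmap f) xs -> forall k : nat, (1 <= k)%N ->
     (g (Fmap f (x_ k)) - g (Fmap f xs) <=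
      complexity f L g (g (Fmap f (x_ 0%N))) (eball xs (enorm (x_ 0%N - xs)%R))
      * ((2 * k%:R)^-1)%:E * (enorm (x_ 0%N - xs) ^+ 2)%:E)%E) /\
  (exists2 xbar, argmin (g \o Fmap f) xbar & x_ @ \oo --> xbar).
Proof.
have g_gtNy := g_proper.1.
split; last first.
  have [xs xs_min] := gF_min.
  exact: (multiprox_cvg L_ge0 f_convex f_C1 f_lip g_convex g_gtNy g_mono g_lsc
    interior_nonempty x_multiprox xs_min).
move=> xs xs_min.
exact: (multiprox_rate L_ge0 f_convex f_C1 f_lip g_convex g_gtNy g_mono
    x_multiprox xs_min).
Qed.
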